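(* Let $(\mathfrak{L},[\cdot,\cdot],\Delta,\alpha)$ be a multiplicative Hom-Lie superbialgebra and let $t\in\mathfrak{L}^{\otimes2}$ be an even element ($|t|=\bar0$) such that $\alpha^{\otimes2}(t)=t$, $t_{21}=-t$, and $$\alpha^{\otimes3}\Big(ad_x\big([[t,t]]^\alpha+\circlearrowleft(\alpha\otimes\Delta)(t)\big)\Big)=0\qquad\text{for all }x\in\mathfrak{L}.$$ Then $\mathfrak{L}_t=(\mathfrak{L},[\cdot,\cdot],\Delta_t=\Delta+ad(t),\alpha)$ is a multiplicative Hom-Lie superbialgebra.
   Context: $\mathbb{K}$ is a field of characteristic $0$; superspaces are $\mathbb{Z}_2$-graded; $|x|$ is the parity of a homogeneous $x$. $\tau(x\otimes y)=(-1)^{|x||y|}y\otimes x$, $\xi(x\otimes y\otimes z)=(-1)^{|x|(|y|+|z|)}y\otimes z\otimes x$, and $\circlearrowleft=1\otimes1\otimes1+\xi+\xi^2$ on $\mathfrak{L}^{\otimes3}$. For $t=\sum t_1\otimes t_2$ with homogeneous $t_1,t_2$, $|t|=|t_1|+|t_2|$ and $t_{21}=\tau(t)$. A Hom-Lie superalgebra $(\mathfrak{L},[\cdot,\cdot],\alpha)$ is a superspace with an even bilinear bracket and an even linear map $\alpha$ with $[x,y]=-(-1)^{|x||y|}[y,x]$ and $(-1)^{|x||z|}[\alpha(x),[y,z]]+(-1)^{|z||y|}[\alpha(z),[x,y]]+(-1)^{|y||x|}[\alpha(y),[z,x]]=0$; it is multiplicative if $\alpha([x,y])=[\alpha(x),\alpha(y)]$.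 A Hom-Lie supercoalgebra $(\mathfrak{L},\Delta,\alpha)$ is a superspace with an even linear map $\alpha$ and an even linear map $\Delta:\mathfrak{L}\to\mathfrak{L}\otimes\mathfrak{L}$ with $\mathrm{Im}\,\Delta\subset\mathrm{Im}(1\otimes1-\tau)$ and $\circlearrowleft(\alpha\otimes\Delta)\circ\Delta=0$; it is co-multiplicative if $\Delta\circ\alpha=\alpha^{\otimes2}\circ\Delta$. For $n\ge2$, $ad_x(y_1\otimes\cdots\otimes y_n)=\sum_{i=1}^n(-1)^{|x|(|y_1|+\cdots+|y_{i-1}|)}\alpha(y_1)\otimes\cdots\otimes\alpha(y_{i-1})\otimes[x,y_i]\otimes\alpha(y_{i+1})\otimes\cdots\otimes\alpha(y_n)$, and $ad(t)(x)=ad_x(t)$. A multiplicative Hom-Lie superbialgebra $(\mathfrak{L},[\cdot,\cdot],\Delta,\alpha)$ consists of a multiplicative Hom-Lie superalgebra $(\mathfrak{L},[\cdot,\cdot],\alpha)$ and a co-multiplicative Hom-Lie supercoalgebra $(\mathfrak{L},\Delta,\alpha)$ with $\Delta([x,y])=ad_{\alpha(x)}(\Delta(y))-(-1)^{|x||y|}ad_{\alpha(y)}(\Delta(x))$. With $t'=\sum t_1'\otimes t_2'$ a second copy of $t$, $[[t,t]]^\alpha=\sum(-1)^{|t_1'||t_2|}[t_1,t_1']\otimes\alpha(t_2)\otimes\alpha(t_2')+\sum\alpha(t_1)\otimes[t_2,t_1']\otimes\alpha(t_2')+\sum(-1)^{|t_1'||t_2|}\alpha(t_1)\otimes\alpha(t_1')\otimes[t_2,t_2']$.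 *)

(* Defs.v *)
From HB Require Import structures.
From mathcomp Require Import all_boot all_algebra.
From mathcomp Require Import boolp.

Set Implicit Arguments.
Unset Strict Implicit.
Unset Printing Implicit Defensive.

Import GRing.Theory.
Local Open Scope ring_scope.
Local Open Scope quotient_scope.

(** * Tensor product of two vector spaces of arbitrary dimension

    A finite formal sum of symbols [x (x) y] is the sequence of the pairs
    [(x, y)]; [U (x) V] is the quotient of the monoid of these sums by the
    congruence that bilinearity generates.  [tlift] is its universal property. *)

Section TensorProduct.
Variables (K : fieldType) (U V : lmodType K).
Implicit Types (s : seq (U * V)) (x : U) (y : V) (a : K).

Inductive tcong : seq (U * V) -> seq (U * V) -> Prop :=
| tcong_refl s : tcong s s
| tcong_sym s1 s2 : tcong s1 s2 -> tcong s2 s1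
| tcong_trans s1 s2 s3 : tcong s1 s2 -> tcong s2 s3 -> tcong s1 s3
| tcong_cat s1 s1' s2 s2' :
    tcong s1 s1' -> tcong s2 s2' -> tcong (s1 ++ s2) (s1' ++ s2')
| tcong_catC s1 s2 : tcong (s1 ++ s2) (s2 ++ s1)
| tcong_0 y : tcong [:: (0, y)] [::]
| tcong_Dl x x' y : tcong [:: (x + x', y)] [:: (x, y); (x', y)]
| tcong_Dr x y y' : tcong [:: (x, y + y')] [:: (x, y); (x, y')]
| tcong_Z a x y : tcong [:: (a *: x, y)] [:: (x, a *: y)].

Definition tcongb : rel (seq (U * V)) := fun s1 s2 => `[< tcong s1 s2 >].

Lemma tcongb_refl : reflexive tcongb.
Proof. by move=> s; apply/asboolP; exact: tcong_refl. Qed.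

Lemma tcongb_sym : symmetric tcongb.
Proof.
by move=> s1 s2; apply/asboolP/asboolP => h; exact: tcong_sym.
Qed.

Lemma tcongb_trans : transitive tcongb.
Proof.
move=> s2 s1 s3 /asboolP h12 /asboolP h23; apply/asboolP.
exact: tcong_trans h12 h23.
Qed.

Canonical tcong_equiv := EquivRel tcongb tcongb_refl tcongb_sym tcongb_trans.

Definition tensor := {eq_quot tcong_equiv}.
HB.instance Definition _ := Choice.on tensor.
HB.instance Definition _ := Quotient.on tensor.

Implicit Types u v w : tensor.

Lemma tensor_eqP s1 s2 : reflect (\pi_tensor s1 = \pi_tensor s2) (tcongb s1 s2).
Proof. by apply: (iffP idP) => [h|/eqmodP//]; apply/eqmodP. Qed.

Lemma pi_tcong s1 s2 : tcong s1 s2 -> \pi_tensor s1 = \pi_tensor s2.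
Proof. by move=> h; apply/tensor_eqP/asboolP. Qed.

Lemma tcong_repr s : tcong (repr (\pi_tensor s)) s.
Proof. by apply/asboolP/tensor_eqP; rewrite reprK. Qed.

Definition tscale_seq a s := [seq (a *: p.1, p.2) | p <- s].

Lemma tcong_scale a s1 s2 :
  tcong s1 s2 -> tcong (tscale_seq a s1) (tscale_seq a s2).
Proof.
elim=> {s1 s2} [s|s1 s2 _|s1 s2 s3 _ h1 _|s1 s1' s2 s2' _ h1 _ h2|s1 s2|y|x x' y|x y y'|b x y].
- exact: tcong_refl.
- exact: tcong_sym.
- exact: tcong_trans.
- by rewrite /tscale_seq !map_cat; exact: tcong_cat.
- by rewrite /tscale_seq !map_cat; exact: tcong_catC.
- by rewrite /tscale_seq /= scaler0; exact: tcong_0.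
- by rewrite /tscale_seq /= scalerDr; exact: tcong_Dl.
- exact: tcong_Dr.
- by rewrite /tscale_seq /= scalerA mulrC -scalerA; exact: tcong_Z.
Qed.

Definition tzero : tensor := \pi_tensor [::].
Definition tadd u v : tensor := \pi_tensor (repr u ++ repr v).
Definition tscale a u : tensor := \pi_tensor (tscale_seq a (repr u)).
Definition topp u : tensor := tscale (- 1) u.

Lemma pi_cat s1 s2 : \pi_tensor (s1 ++ s2) = tadd (\pi s1) (\pi s2).
Proof.
by apply: pi_tcong; apply/tcong_cat; apply: tcong_sym; exact: tcong_repr.
Qed.

Lemma pi_scale a s : \pi_tensor (tscale_seq a s) = tscale a (\pi s).
Proof. by apply/pi_tcong/tcong_scale/tcong_sym/tcong_repr. Qed.

Lemma taddA : associative tadd.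
Proof.
move=> u v w; rewrite -[u]reprK -[v]reprK -[w]reprK.
by rewrite -!pi_cat catA.
Qed.

Lemma taddC : commutative tadd.
Proof. by move=> u v; apply: pi_tcong; exact: tcong_catC. Qed.

Lemma tadd0 : left_id tzero tadd.
Proof. by move=> u; rewrite -[u]reprK -pi_cat. Qed.

Lemma taddACA : interchange tadd tadd.
Proof.
move=> u v w z.
by rewrite -!taddA; congr tadd; rewrite !taddA [tadd v w]taddC.
Qed.

Lemma tscaleDr a : {morph tscale a : u v / tadd u v}.
Proof.
move=> u v; rewrite -[u]reprK -[v]reprK -pi_cat -!pi_scale -pi_cat.
by rewrite /tscale_seq map_cat.
Qed.

Lemma tscaleA a b u : tscale a (tscale b u) = tscale (a * b) u.
Proof.
rewrite -[u]reprK -!pi_scale /tscale_seq -map_comp.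
by congr (\pi _); apply: eq_map => p /=; rewrite scalerA.
Qed.

Lemma tscale1 u : tscale 1 u = u.
Proof.
rewrite -[u in RHS]reprK /tscale /tscale_seq; congr (\pi _).
by rewrite -[RHS]map_id; apply: eq_map => -[x y] /=; rewrite scale1r.
Qed.

Lemma tscaleDl u a b : tscale (a + b) u = tadd (tscale a u) (tscale b u).
Proof.
rewrite -[u]reprK; elim: (repr u) => [|[x y] s IH].
  by rewrite -!pi_scale -pi_cat.
rewrite -cat1s pi_cat !tscaleDr IH taddACA; congr tadd.
by rewrite -!pi_scale -pi_cat; apply: pi_tcong; rewrite /= scalerDl; exact: tcong_Dl.
Qed.

Lemma tscale0 u : tscale 0 u = tzero.
Proof.
rewrite -[u]reprK; elim: (repr u) => [|[x y] s IH]; first by rewrite -pi_scale.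
rewrite -cat1s pi_cat tscaleDr IH taddC tadd0 -pi_scale.
by apply: pi_tcong; rewrite /= scale0r; exact: tcong_0.
Qed.

Lemma taddN : left_inverse tzero topp tadd.
Proof.
move=> u; rewrite /topp -{2}[u]tscale1 -tscaleDl.
by rewrite addNr tscale0.
Qed.

HB.instance Definition _ := GRing.isZmodule.Build tensor taddA taddC tadd0 taddN.
HB.instance Definition _ := GRing.Zmodule_isLmodule.Build K tensor
  tscaleA tscale1 tscaleDr tscaleDl.

Lemma tensor_piD s1 s2 :
  \pi_tensor (s1 ++ s2) = \pi_tensor s1 + \pi_tensor s2.
Proof. exact: pi_cat. Qed.

Lemma tensor_piZ a s : \pi_tensor (tscale_seq a s) = a *: \pi_tensor s.
Proof. exact: pi_scale. Qed.

Definition tpure x y : tensor := \pi_tensor [:: (x, y)].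

End TensorProduct.

Notation "U '⊗' V" := (tensor U%type V%type) (at level 40, left associativity) : type_scope.
Notation "x '⊗' y" := (tpure x y) (at level 40, left associativity) : ring_scope.


Notation bilinear_map f := (bilinear_for *:%R *:%R f).

Section LinearAux.
Variables (K : fieldType) (U V W : lmodType K).

Lemma linear_at0 (f : U -> W) : linear f -> f 0 = 0.
Proof. by move=> /(_ (- 1) 0 0) /=; rewrite !scaleN1r !addNr. Qed.

Lemma linear_atD (f : U -> W) x y : linear f -> f (x + y) = f x + f y.
Proof. by move=> /(_ 1 x y) /=; rewrite !scale1r. Qed.

Lemma linear_atZ (f : U -> W) a x : linear f -> f (a *: x) = a *: f x.
Proof.
by move=> fl; have := fl a x 0; rewrite /= (linear_at0 fl) !addr0.
Qed.

End LinearAux.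

Section UniversalProperty.
Variables (K : fieldType) (U V : lmodType K).

Lemma tensor_ind (P : U ⊗ V -> Prop) :
    P 0 -> (forall u v, P u -> P v -> P (u + v)) ->
  (forall x y, P (x ⊗ y)) -> forall u, P u.
Proof.
move=> P0 PD Pp u; rewrite -[u]reprK; elim: (repr u) => [|[x y] s IH] //.
by rewrite -cat1s pi_cat; apply: PD => //; exact: Pp.
Qed.

Lemma tpure_bilinear : bilinear_map (@tpure K U V).
Proof.
have Dl (x x' : U) (y : V) : (x + x') ⊗ y = x ⊗ y + x' ⊗ y.
  by apply: etrans (pi_cat [:: (x, y)] [:: (x', y)]); apply/pi_tcong/tcong_Dl.
have Dr (x : U) (y y' : V) : x ⊗ (y + y') = x ⊗ y + x ⊗ y'.
  by apply: etrans (pi_cat [:: (x, y)] [:: (x, y')]); apply/pi_tcong/tcong_Dr.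
have Zl a (x : U) (y : V) : (a *: x) ⊗ y = a *: (x ⊗ y).
  exact: pi_scale a [:: (x, y)].
have Zr a (x : U) (y : V) : x ⊗ (a *: y) = a *: (x ⊗ y).
  by rewrite -Zl; apply/esym/pi_tcong/tcong_Z.
by split=> [y a x x'|x a y y'] /=; rewrite ?Dl ?Dr ?Zl ?Zr.
Qed.

HB.instance Definition _ :=
  bilinear_isBilinear.Build K U V (tensor U V) *:%R *:%R (@tpure K U V)
    tpure_bilinear.

(** [tlift f] is the linear map [x ⊗ y |-> f x y], for [f] bilinear.  It is
    defined on a representative of the tensor, hence only meaningful if [f]
    is bilinear. *)
Definition tlift (W : lmodType K) (f : U -> V -> W) (u : U ⊗ V) : W :=
  \sum_(p <- repr u) f p.1 p.2.

Section Lift.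
Variables (W : lmodType K) (f : U -> V -> W).
Hypothesis f_bilin : bilinear_map f.

Lemma tlift_pi s : tlift f (\pi s) = \sum_(p <- s) f p.1 p.2.
Proof.
have eq_sum s1 s2 : tcong s1 s2 ->
    \sum_(p <- s1) f p.1 p.2 = \sum_(p <- s2) f p.1 p.2; last first.
  exact: eq_sum (tcong_repr s).
have fl y : linear (f ^~ y) := f_bilin.1 y.
have fr x : linear (f x) := f_bilin.2 x.
elim=> {s1 s2}.
- by [].
- by move=> s1 s2 _ ->.
- by move=> s1 s2 s3 _ -> _ ->.
- by move=> s1 s1' s2 s2' _ h1 _ h2; rewrite !big_cat /= h1 h2.
- by move=> s1 s2; rewrite !big_cat /= addrC.
- by move=> y; rewrite big_seq1 big_nil /= (linear_at0 (fl y)).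
- by move=> x x' y; rewrite !big_cons !big_nil !addr0 /= (linear_atD _ _ (fl y)).
- by move=> x y y'; rewrite !big_cons !big_nil !addr0 /= (linear_atD _ _ (fr x)).
- move=> a x y; rewrite !big_seq1 /= (linear_atZ _ _ (fr x)).
  by rewrite (linear_atZ _ _ (fl y)).
Qed.

Lemma tliftE x y : tlift f (x ⊗ y) = f x y.
Proof. by rewrite tlift_pi big_seq1. Qed.

Lemma tlift_linear : linear (tlift f).
Proof.
move=> a u v; rewrite -[u]reprK -[v]reprK.
rewrite -tensor_piZ -tensor_piD !tlift_pi.
rewrite big_cat /= big_map scaler_sumr; congr (_ + _).
by apply: eq_bigr => p _; rewrite (linear_atZ _ _ (f_bilin.1 p.2)).
Qed.

Lemma tlift_uniq (g : U ⊗ V -> W) :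
  linear g -> (forall x y, g (x ⊗ y) = f x y) -> g =1 tlift f.
Proof.
move=> gl gE; have tl := tlift_linear.
elim/tensor_ind => [|u v hu hv|x y].
- by rewrite (linear_at0 gl) (linear_at0 tl).
- by rewrite (linear_atD _ _ gl) (linear_atD _ _ tl) hu hv.
- by rewrite gE tliftE.
Qed.

End Lift.
End UniversalProperty.

(** [tmap f g] is [f ⊗ g]. *)
Definition tmap (K : fieldType) (U V U' V' : lmodType K)
    (f : U -> U') (g : V -> V') : U ⊗ V -> U' ⊗ V' :=
  tlift (fun x y => f x ⊗ g y).

Lemma tmap_bilinear (K : fieldType) (U V U' V' : lmodType K)
    (f : U -> U') (g : V -> V') :
  linear f -> linear g -> bilinear_map (fun x y => f x ⊗ g y).
Proof.
move=> fl gl; split=> [y a x x'|x a y y'] /=.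
  by rewrite fl linearPl.
by rewrite gl linearPr.
Qed.

Lemma tmap_linear (K : fieldType) (U V U' V' : lmodType K)
    (f : U -> U') (g : V -> V') :
  linear f -> linear g -> linear (tmap f g).
Proof. by move=> fl gl; apply/tlift_linear/tmap_bilinear. Qed.

Lemma tmapE (K : fieldType) (U V U' V' : lmodType K)
    (f : U -> U') (g : V -> V') x y :
  linear f -> linear g -> tmap f g (x ⊗ y) = f x ⊗ g y.
Proof. by move=> fl gl; rewrite /tmap tliftE//; exact: tmap_bilinear. Qed.

(** * Superspaces

    Parities are booleans ([false] is even), added with [(+)] and multiplied
    with [&&].  A decomposition [V = V_0 (+) V_1] is given by its two
    projections [hcomp false] and [hcomp true]. *)

HB.mixin Record isSuperspace (K : fieldType) (V : Type) of GRing.Lmodule K V := {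
  hcomp : bool -> V -> V;
  hcomp_linear : forall i, linear (hcomp i);
  hcomp_hcomp : forall i j x, hcomp i (hcomp j x) = if i == j then hcomp j x else 0;
  hcomp_sum : forall x, hcomp false x + hcomp true x = x
}.

#[short(type="superType")]
HB.structure Definition Superspace (K : fieldType) :=
  { V of isSuperspace K V & GRing.Lmodule K V }.

Section Grading.
Variables (K : fieldType) (V : superType K).

HB.instance Definition _ i := GRing.isLinear.Build K V V *:%R
  (@hcomp K V i) (@hcomp_linear K V i).

(** [x] lies in [V_i]. *)
Definition homog (i : bool) (x : V) : Prop := hcomp i x = x.

Lemma homogE i j x : homog i x -> hcomp j x = if i == j then x else 0.
Proof. by rewrite /homog => <-; rewrite hcomp_hcomp eq_sym. Qed.

Lemma hcomp_homog i x : homog i (hcomp i x).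
Proof. by rewrite /homog hcomp_hcomp eqxx. Qed.

End Grading.

Definition even_map (K : fieldType) (V W : superType K) (f : V -> W) : Prop :=
  forall i x, homog i x -> homog i (f x).

(** [(V ⊗ W)_i] is the direct sum of the [V_j ⊗ W_k] with [j + k = i]. *)
Section TensorGrading.
Variables (K : fieldType) (V W : superType K).

Definition tensor_hcomp (i : bool) (u : V ⊗ W) : V ⊗ W :=
  \sum_(j : bool) tmap (hcomp j) (hcomp (i (+) j)) u.

Let tmap_hcomp_linear i j : linear (tmap (@hcomp K V i) (@hcomp K W j)).
Proof. by apply: tmap_linear; exact: hcomp_linear. Qed.

Let tensor_hcompE i (x : V) (y : W) :
  tensor_hcomp i (x ⊗ y) = \sum_(j : bool) hcomp j x ⊗ hcomp (i (+) j) y.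
Proof. by apply: eq_bigr => j _; rewrite tmapE //; exact: hcomp_linear. Qed.

Lemma tensor_hcomp_linear i : linear (tensor_hcomp i).
Proof.
move=> a u v; rewrite /tensor_hcomp scaler_sumr -big_split /=.
by apply: eq_bigr => j _; rewrite tmap_hcomp_linear.
Qed.

HB.instance Definition _ i := GRing.isLinear.Build K (tensor V W) (tensor V W) *:%R
  (tensor_hcomp i) (tensor_hcomp_linear i).

Lemma tensor_hcomp_hcomp i j u :
  tensor_hcomp i (tensor_hcomp j u) = if i == j then tensor_hcomp j u else 0.
Proof.
elim/tensor_ind: u => [|u v hu hv|x y].
- by rewrite !linear0 if_same.
- by rewrite !linearD /= hu hv; case: eqP => _ //; rewrite addr0.
- rewrite tensor_hcompE linear_sum /=.
  under eq_bigr do rewrite tensor_hcompE.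
  rewrite !big_bool /= !hcomp_hcomp.
  by case: i j => -[] /=; rewrite ?linear0l ?linear0r ?addr0 ?add0r.
Qed.

Lemma tensor_hcomp_sum u : tensor_hcomp false u + tensor_hcomp true u = u.
Proof.
elim/tensor_ind: u => [|u v hu hv|x y].
- by rewrite !linear0 addr0.
- by rewrite !linearD /= addrACA hu hv.
- rewrite -[X in _ = X ⊗ _](hcomp_sum x) -[X in _ = _ ⊗ X](hcomp_sum y).
  rewrite linearDl /= !linearDr /= !tensor_hcompE !big_bool /=.
  rewrite [X in X + _ = _]addrC [X in _ + X = _]addrC addrACA.
  by congr (_ + _); rewrite addrC.
Qed.

HB.instance Definition _ := isSuperspace.Build K (tensor V W)
  tensor_hcomp_linear tensor_hcomp_hcomp tensor_hcomp_sum.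

Lemma homog_tpure i j (x : V) (y : W) :
  homog i x -> homog j y -> homog (i (+) j) (x ⊗ y).
Proof.
move=> hx hy; rewrite /homog /hcomp /= tensor_hcompE big_bool.
rewrite !(homogE _ hx) !(homogE _ hy).
by case: i j {hx hy} => -[] /=; rewrite ?linear0l ?linear0r ?addr0 ?add0r.
Qed.

End TensorGrading.

(** The bilinear map that sends homogeneous [x], [y] to
    [(-1)^(|x||y|) f(x, y)], for [f] bilinear. *)
Definition koszul (K : fieldType) (V W : superType K) (U : lmodType K)
    (f : V -> W -> U) (x : V) (y : W) : U :=
  \sum_(i : bool) \sum_(j : bool) (-1) ^+ (i && j) *: f (hcomp i x) (hcomp j y).

Lemma koszulE (K : fieldType) (V W : superType K) (U : lmodType K)
    (f : V -> W -> U) i j x y :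
  bilinear_map f -> homog i x -> homog j y ->
  koszul f x y = (-1) ^+ (i && j) *: f x y.
Proof.
move=> fb hx hy; rewrite /koszul !big_bool !(homogE _ hx) !(homogE _ hy).
have f0l z : f 0 z = 0 := linear_at0 (fb.1 z).
have f0r z : f z 0 = 0 := linear_at0 (fb.2 z).
by case: i j {hx hy} => -[] /=; rewrite ?f0l ?f0r ?scaler0 ?addr0 ?add0r.
Qed.

Lemma koszul_bilinear (K : fieldType) (V W : superType K) (U : lmodType K)
    (f : V -> W -> U) : bilinear_map f -> bilinear_map (koszul f).
Proof.
move=> fb; split=> [y a x x'|x a y y'] /=; rewrite /koszul.
  rewrite scaler_sumr -big_split /=; apply: eq_bigr => i _.
  rewrite scaler_sumr -big_split /=; apply: eq_bigr => j _.
  by rewrite linearP fb.1 scalerDr !scalerA mulrC.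
rewrite scaler_sumr -big_split /=; apply: eq_bigr => i _.
rewrite scaler_sumr -big_split /=; apply: eq_bigr => j _.
by rewrite linearP fb.2 scalerDr !scalerA mulrC.
Qed.

Lemma koszul_param (K : fieldType) (P : lmodType K) (V W : superType K)
    (U : lmodType K) (f : P -> V -> W -> U) :
  (forall x y, linear (fun p => f p x y)) ->
  forall x y, linear (fun p => koszul (f p) x y).
Proof.
move=> fl x y a p q; rewrite /= /koszul.
rewrite scaler_sumr -big_split /=; apply: eq_bigr => i _.
rewrite scaler_sumr -big_split /=; apply: eq_bigr => j _.
by rewrite (fl _ _ a p q) /= scalerDr !scalerA mulrC.
Qed.

Lemma linear_add (K : fieldType) (U V : lmodType K) (f g : U -> V) :
  linear f -> linear g -> linear (fun x => f x + g x).
Proof.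
by move=> fl gl a x y; rewrite (fl a x y) (gl a x y) /= scalerDr addrACA.
Qed.

Lemma tpure_linearl (K : fieldType) (P U V : lmodType K) (f : P -> U) (y : V) :
  linear f -> linear (fun p => f p ⊗ y).
Proof. by move=> fl a p q; rewrite (fl a p q) linearPl. Qed.

Lemma tpure_linearr (K : fieldType) (P U V : lmodType K) (x : U) (f : P -> V) :
  linear f -> linear (fun p => x ⊗ f p).
Proof. by move=> fl a p q; rewrite (fl a p q) linearPr. Qed.

Lemma tlift_param (K : fieldType) (P U V W : lmodType K) (f : P -> U -> V -> W) :
  (forall x y, linear (fun p => f p x y)) ->
  forall u, linear (fun p => tlift (f p) u).
Proof.
move=> fl u a p q; rewrite /= /tlift scaler_sumr -big_split /=.
by apply: eq_bigr => s _; rewrite (fl _ _ a p q).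
Qed.

Section Operators.
Variables (K : fieldType) (L : superType K).

Definition tau : L ⊗ L -> L ⊗ L :=
  tlift (koszul (fun x y : L => y ⊗ x)).

(** [L^{⊗3}] is [L ⊗ (L ⊗ L)]. *)
Definition tlift3 (W : lmodType K) (f : L -> L -> L -> W) : L ⊗ (L ⊗ L) -> W :=
  tlift (fun x u => tlift (f x) u).

(** The sign of [xi (x ⊗ (y ⊗ z))] is that of [|x|] against [|y ⊗ z|]. *)
Definition xi : L ⊗ (L ⊗ L) -> L ⊗ (L ⊗ L) :=
  tlift (koszul (fun (x : L) (u : L ⊗ L) => tlift (fun y z => y ⊗ (z ⊗ x)) u)).

Definition cyc (w : L ⊗ (L ⊗ L)) : L ⊗ (L ⊗ L) := w + xi w + xi (xi w).

Variables (br : L -> L -> L) (alpha : L -> L).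

(** [ad_x] on [L^{⊗2}] and on [L^{⊗3}]. *)
Definition ad2 (x : L) : L ⊗ L -> L ⊗ L :=
  tlift (fun y1 y2 =>
    br x y1 ⊗ alpha y2 + koszul (fun x y1 => alpha y1 ⊗ br x y2) x y1).

Definition ad3 (x : L) : L ⊗ (L ⊗ L) -> L ⊗ (L ⊗ L) :=
  tlift3 (fun y1 y2 y3 =>
    br x y1 ⊗ (alpha y2 ⊗ alpha y3)
    + koszul (fun x y1 => alpha y1 ⊗ (br x y2 ⊗ alpha y3)) x y1
    + koszul (fun x y1 =>
        koszul (fun x y2 => alpha y1 ⊗ (alpha y2 ⊗ br x y3)) x y2) x y1).

(** [[t, t']]^alpha *)
Definition hbrack (t t' : L ⊗ L) : L ⊗ (L ⊗ L) :=
  tlift (fun t1 t2 => tlift (fun t1' t2' =>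
    koszul (fun t1' t2 => br t1 t1' ⊗ (alpha t2 ⊗ alpha t2')) t1' t2
    + alpha t1 ⊗ (br t2 t1' ⊗ alpha t2')
    + koszul (fun t1' t2 => alpha t1 ⊗ (alpha t1' ⊗ br t2 t2')) t1' t2) t') t.

#[local] Ltac lin := first
  [ exact: (fun _ _ _ => erefl)
  | assumption
  | match goal with H : bilinear_for _ _ _ |- _ =>
      first [exact: (H.1 _) | exact: (H.2 _)] end
  | apply: tpure_linearl; lin
  | apply: tpure_linearr; lin
  | apply: linear_add; lin
  | apply: koszul_param => ? ?; lin
  | apply: (koszul_bilinear _).1; split => ?; lin
  | apply: (koszul_bilinear _).2; split => ?; lin
  | apply: tlift_param => ? ?; lin
  | apply: tlift_linear; split => ?; lin ].

Lemma tauE i j (x y : L) : homog i x -> homog j y ->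
  tau (x ⊗ y) = (-1) ^+ (i && j) *: (y ⊗ x).
Proof.
move=> hx hy; have fb : bilinear_map (fun x y : L => y ⊗ x) by split=> ?; lin.
by rewrite /tau tliftE ?(koszulE fb hx hy) //; exact: koszul_bilinear.
Qed.

Lemma xiE i j k (x y z : L) : homog i x -> homog j y -> homog k z ->
  xi (x ⊗ (y ⊗ z)) = (-1) ^+ (i && (j (+) k)) *: (y ⊗ (z ⊗ x)).
Proof.
move=> hx hy hz.
have fb : bilinear_map
    (fun (x : L) (u : L ⊗ L) => tlift (fun y z => y ⊗ (z ⊗ x)) u).
  by split=> ?; lin.
rewrite /xi tliftE ?(koszulE fb hx (homog_tpure hy hz)).
  by rewrite tliftE //; split=> ?; lin.
exact: koszul_bilinear.
Qed.

Hypothesis br_bilin : bilinear_map br.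
Hypothesis alpha_lin : linear alpha.

Lemma ad2E i j (x y1 y2 : L) : homog i x -> homog j y1 ->
  ad2 x (y1 ⊗ y2) =
    br x y1 ⊗ alpha y2 + (-1) ^+ (i && j) *: (alpha y1 ⊗ br x y2).
Proof.
move=> hx hy; rewrite /ad2 tliftE; last by split=> ?; lin.
by rewrite (koszulE _ hx hy) //; split=> ?; lin.
Qed.

Lemma ad3E i j k (x y1 y2 y3 : L) : homog i x -> homog j y1 -> homog k y2 ->
  ad3 x (y1 ⊗ (y2 ⊗ y3)) =
    br x y1 ⊗ (alpha y2 ⊗ alpha y3)
    + (-1) ^+ (i && j) *: (alpha y1 ⊗ (br x y2 ⊗ alpha y3))
    + (-1) ^+ (i && (j (+) k)) *: (alpha y1 ⊗ (alpha y2 ⊗ br x y3)).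
Proof.
move=> hx hy hz; rewrite /ad3 /tlift3 tliftE; last by split=> ?; lin.
rewrite tliftE; last by split=> ?; lin.
rewrite (koszulE _ hx hy); last by split=> ?; lin.
rewrite (koszulE _ hx hy); last by split=> ?; lin.
rewrite (koszulE _ hx hz); last by split=> ?; lin.
by rewrite scalerA; case: i j k {hx hy hz} => -[] [];
  rewrite /= ?expr0 ?expr1 ?mulr1 ?mul1r ?mulrNN ?mulr1.
Qed.

Lemma hbrackE i j (t1 t2 t1' t2' : L) : homog i t1' -> homog j t2 ->
  hbrack (t1 ⊗ t2) (t1' ⊗ t2') =
    (-1) ^+ (i && j) *: (br t1 t1' ⊗ (alpha t2 ⊗ alpha t2'))
    + alpha t1 ⊗ (br t2 t1' ⊗ alpha t2')
    + (-1) ^+ (i && j) *: (alpha t1 ⊗ (alpha t1' ⊗ br t2 t2')).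
Proof.
move=> ht1' ht2; rewrite /hbrack tliftE; last by split=> ?; lin.
rewrite tliftE; last by split=> ?; lin.
rewrite (koszulE _ ht1' ht2); last by split=> ?; lin.
by rewrite (koszulE _ ht1' ht2) //; split=> ?; lin.
Qed.

Lemma hbrack_bilinear : bilinear_map hbrack.
Proof. by split=> ?; rewrite /hbrack; lin. Qed.

End Operators.

Section HomLie.
Variables (K : fieldType) (L : superType K).
Variables (br : L -> L -> L) (Delta : L -> L ⊗ L) (alpha : L -> L).

Record HomLieSuperalgebra : Prop := {
  br_bilinear : bilinear_map br;
  br_even : forall i j x y, homog i x -> homog j y -> homog (i (+) j) (br x y);
  alg_alpha_linear : linear alpha;
  alg_alpha_even : even_map alpha;
  br_skew : forall i j x y, homog i x -> homog j y ->
    br x y = - ((-1) ^+ (i && j) *: br y x);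
  br_jacobi : forall i j k x y z, homog i x -> homog j y -> homog k z ->
    (-1) ^+ (i && k) *: br (alpha x) (br y z)
    + (-1) ^+ (k && j) *: br (alpha z) (br x y)
    + (-1) ^+ (j && i) *: br (alpha y) (br z x) = 0
}.

Definition multiplicative : Prop :=
  forall x y, alpha (br x y) = br (alpha x) (alpha y).

Record HomLieSupercoalgebra : Prop := {
  Delta_linear : linear Delta;
  Delta_even : even_map Delta;
  coalg_alpha_linear : linear alpha;
  coalg_alpha_even : even_map alpha;
  Delta_skew : forall x, exists s, Delta x = s - tau s;
  Delta_cojacobi : forall x, cyc (tmap alpha Delta (Delta x)) = 0
}.

Definition comultiplicative : Prop :=
  forall x, Delta (alpha x) = tmap alpha alpha (Delta x).

Record MultHomLieSuperbialgebra : Prop := {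
  bialg_alg : HomLieSuperalgebra;
  bialg_mult : multiplicative;
  bialg_coalg : HomLieSupercoalgebra;
  bialg_comult : comultiplicative;
  bialg_compat : forall i j x y, homog i x -> homog j y ->
    Delta (br x y) = ad2 br alpha (alpha x) (Delta y)
      - (-1) ^+ (i && j) *: ad2 br alpha (alpha y) (Delta x)
}.

End HomLie.

(* Main.v *)
Require Import Defs.
From mathcomp Require Import all_boot all_algebra.
Import GRing.Theory.
Local Open Scope ring_scope.

(** The only axiom of [L_t] that is not routine is the co-Jacobi identity.  Write
    [t = sum a ⊗ b] and let [mid] be the sum of the [alpha(a) ⊗ [b,a'] ⊗ alpha(b')].
    Skew-symmetry of [t] gives [[t,t]]^alpha = cyc mid.  As [cyc] does not see [xi],
    - the Hom-Jacobi identity shows that [(alpha ⊗ ad(t))(ad_x t)] and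
      [ad_{alpha(x)} mid] have the same [cyc];
    - by compatibility, [(alpha ⊗ Delta)(ad_x t)] is
      [ad_{alpha(x)}((alpha ⊗ Delta)(t))] minus an error term, whose [cyc] is that of
      [(alpha ⊗ ad(t))(Delta x)] because both [t] and [Delta x] are skew.
    Since [t] is [alpha]-invariant, the co-Jacobi sum of [Delta + ad(t)] is therefore
    [alpha^{⊗3} ad_x] of [[t,t]]^alpha + cyc((alpha ⊗ Delta)(t)). *)

Set Implicit Arguments.
Unset Strict Implicit.
Unset Printing Implicit Defensive.

(** * Closure properties of linear maps *)

Section LinearClosure.
Variables (K : fieldType) (U V W : lmodType K).

Lemma linear_sumE (f : U -> V) (I : finType) (F : I -> U) :
  linear f -> f (\sum_n F n) = \sum_n f (F n).
Proof.
move=> fl; apply: (big_morph f) => [x y|]; first exact: linear_atD.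
exact: linear_at0.
Qed.

Lemma linear_compose (f : V -> W) (g : U -> V) :
  linear f -> linear g -> linear (fun p => f (g p)).
Proof. by move=> fl gl c p q; rewrite /= gl fl. Qed.

Lemma linear_scale (c : K) (f : U -> V) : linear f -> linear (fun p => c *: f p).
Proof. by move=> fl d p q; rewrite /= fl scalerDr !scalerA mulrC. Qed.

Lemma linear_bigsum (I : finType) (F : I -> U -> V) :
  (forall n, linear (F n)) -> linear (fun p => \sum_n F n p).
Proof.
move=> Fl d p q; rewrite /= scaler_sumr -big_split.
by apply: eq_bigr => n _; rewrite Fl.
Qed.

End LinearClosure.

Lemma signr_scale_eq0 (K : fieldType) (V : lmodType K) (b : bool) (u : V) :
  ((-1) ^+ b *: u == 0) = (u == 0).
Proof. by rewrite scaler_eq0 signr_eq0. Qed.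

Section BilinearClosure.
Variables (K : fieldType) (U V W : lmodType K).

Lemma bilinear_linearl (f : U -> V -> W) (P : lmodType K) (g : P -> U) y :
  bilinear_map f -> linear g -> linear (fun p => f (g p) y).
Proof. by move=> fb gl; exact: (linear_compose (fb.1 y) gl). Qed.

Lemma bilinear_linearr (f : U -> V -> W) (P : lmodType K) (g : P -> V) x :
  bilinear_map f -> linear g -> linear (fun p => f x (g p)).
Proof. by move=> fb gl; exact: (linear_compose (fb.2 x) gl). Qed.

End BilinearClosure.

(** Proves linearity by recursion on the shape of the map, with the linear and bilinear maps among
    the hypotheses as building blocks. *)
Ltac lin := first
  [ exact: (fun _ _ _ => erefl)
  | assumption
  | match goal with H : bilinear_for _ _ _ |- _ =>
      first [ exact: (H.1 _) | exact: (H.2 _)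
            | apply: (bilinear_linearl _ H); lin
            | apply: (bilinear_linearr _ H); lin ] end
  | match goal with H : GRing.linear_for _ _ |- _ =>
      apply: (linear_compose H); lin end
  | exact: hcomp_linear
  | apply: tpure_linearl; lin
  | apply: tpure_linearr; lin
  | apply: linear_scale; lin
  | apply: linear_add; lin
  | apply: linear_bigsum => ?; lin
  | apply: koszul_param => ? ?; lin
  | apply: (koszul_bilinear _).1; split => ?; lin
  | apply: (koszul_bilinear _).2; split => ?; lin
  | apply: tlift_param => ? ?; lin
  | apply: tlift_linear; split => ?; lin ].

Ltac bilin := split => ?; lin.

(** Meant for goals whose parities are all constants: each power of [-1] is evaluated and the minus
    signs are pulled out of tensors and sums. *)
Ltac signs := rewrite /= ?(expr0, expr1, scale1r, scaleN1r, opprK);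
  do ?rewrite (mulr1, mulrN1, linearNl, linearNr, opprK, opprD, scale1r, scaleN1r).

(** * The twist, the cyclic permutation and homogeneous decompositions *)

Section Operators.
Variables (K : fieldType) (L : superType K).

Lemma tau_linear : linear (@tau K L).
Proof. by rewrite /tau; lin. Qed.

Lemma xi_linear : linear (@xi K L).
Proof. by rewrite /xi; lin. Qed.

Lemma cyc_linear : linear (@cyc K L).
Proof. by have xl := xi_linear; rewrite /cyc; lin. Qed.

(** No case for [0] is needed: [hcomp_sum] writes every vector as a sum of exactly two homogeneous
    ones. *)
Lemma homog_ind (P : L -> Prop) :
    (forall x y, P x -> P y -> P (x + y)) ->
  (forall i x, homog i x -> P x) -> forall x, P x.
Proof.
by move=> PD Ph x; rewrite -(hcomp_sum x); apply: PD; apply: Ph; exact: hcomp_homog.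
Qed.

Lemma tensor2_homog_ind (P : (L ⊗ L)%type -> Prop) :
    P 0 -> (forall u v, P u -> P v -> P (u + v)) ->
    (forall i j x y, homog i x -> homog j y -> P (x ⊗ y)) ->
  forall u, P u.
Proof.
move=> P0 PD Pp; elim/tensor_ind => // x y.
elim/homog_ind: x => [x x' hx hx'|i x hx]; first by rewrite linearDl; exact: PD.
elim/homog_ind: y => [y y' hy hy'|j y hy]; first by rewrite linearDr; exact: PD.
exact: Pp hx hy.
Qed.

Lemma tensor3_homog_ind (P : (L ⊗ (L ⊗ L))%type -> Prop) :
    P 0 -> (forall u v, P u -> P v -> P (u + v)) ->
    (forall i j k x y z, homog i x -> homog j y -> homog k z ->
       P (x ⊗ (y ⊗ z))) ->
  forall u, P u.
Proof.
move=> P0 PD Pp; elim/tensor_ind => // x u.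
elim/homog_ind: x => [x x' hx hx'|i x hx]; first by rewrite linearDl; exact: PD.
elim/tensor2_homog_ind: u => [|u v hu hv|j k y z hy hz].
- by rewrite linear0r.
- by rewrite linearDr; exact: PD.
- exact: Pp hx hy hz.
Qed.

Lemma tauK : involutive (@tau K L).
Proof.
have tl := tau_linear => u.
elim/tensor2_homog_ind: u => [|u v hu hv|i j x y hx hy].
- by rewrite !(linear_at0 tl).
- by rewrite !(linear_atD _ _ tl) hu hv.
rewrite (tauE hx hy) (linear_atZ _ _ tl) (tauE hy hx) scalerA -exprD.
by case: i j {hx hy} => -[]; rewrite ?expr0 ?sqrrN ?expr1n ?scale1r.
Qed.

(** The total sign exponent [|x|(|y|+|z|) + |y|(|z|+|x|) + |z|(|x|+|y|)] counts each product twice,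
    so it is even. *)
Lemma xiK3 (u : (L ⊗ (L ⊗ L))%type) : xi (xi (xi u)) = u.
Proof.
have xl := xi_linear.
elim/tensor3_homog_ind: u => [|u v hu hv|i j k x y z hx hy hz].
- by rewrite !(linear_at0 xl).
- by rewrite !(linear_atD _ _ xl) hu hv.
rewrite (xiE hx hy hz) (linear_atZ _ _ xl) (xiE hy hz hx) !(linear_atZ _ _ xl).
rewrite (xiE hz hx hy) !scalerA.
by rewrite -!signr_addb; case: i j k {hx hy hz} => -[] []; rewrite scale1r.
Qed.

Lemma cyc_xi (u : (L ⊗ (L ⊗ L))%type) : cyc (xi u) = cyc u.
Proof. by rewrite /cyc xiK3 addrC addrA. Qed.

(** Indexed families of homogeneous factors let the Koszul signs be read off the index. *)
Lemma tensor_decomp i (t : (L ⊗ L)%type) : homog i t ->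
  exists (I : finType) (j : I -> bool) (a b : I -> L),
    [/\ forall n, homog (j n) (a n), forall n, homog (i (+) j n) (b n)
      & t = \sum_n a n ⊗ b n].
Proof.
move=> ht; pose s := generic_quotient.repr t.
(* An index is a pair of the representative together with the parity of the left factor; the degree
   [i] then fixes the parity of the right factor. *)
exists ('I_(size s) * bool)%type, snd.
exists (fun n => hcomp n.2 (tnth (in_tuple s) n.1).1).
exists (fun n => hcomp (i (+) n.2) (tnth (in_tuple s) n.1).2).
split=> [n|n|]; [exact: hcomp_homog|exact: hcomp_homog|].
rewrite -[LHS]ht /hcomp /= /tensor_hcomp /tmap /tlift.
rewrite -(pair_bigA _ (fun m j => hcomp j (tnth (in_tuple s) m).1
   ⊗ hcomp (i (+) j) (tnth (in_tuple s) m).2)) /= exchange_big /=.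
by rewrite (big_tnth _ _ s).
Qed.

(* [f] may depend on the parity of its first argument, which absorbs the
   Koszul signs. *)
Lemma skew_sum (W : lmodType K) i (I : finType) (j : I -> bool) (a b : I -> L)
    (f : bool -> L -> L -> W) :
    (forall n, homog (j n) (a n)) -> (forall n, homog (i (+) j n) (b n)) ->
    tau (\sum_n a n ⊗ b n) = - \sum_n a n ⊗ b n ->
    (forall p, bilinear_map (f p)) ->
  \sum_n f (j n) (a n) (b n)
    = - \sum_n (-1) ^+ (j n && (i (+) j n)) *: f (i (+) j n) (b n) (a n).
Proof.
move=> ha hb ht fb.
(* [F] glues the maps [f p] into one bilinear map that detects the parity of its first argument, so
   [tlift F] can be applied to both sides of [ht]. *)
pose F x y := \sum_(p : bool) f p (hcomp p x) y.
have Fb : bilinear_map F.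
  split=> ?; apply: linear_bigsum => p.
    exact: (linear_compose ((fb p).1 _) (@hcomp_linear K L p)).
  exact: (fb p).2.
have Fl := tlift_linear Fb.
have FE p x y : homog p x -> F x y = f p x y.
  move=> hx; rewrite /F big_bool !(homogE _ hx).
  have f0 q : f q 0 y = 0 by exact: linear_at0 ((fb q).1 y).
  by case: p {hx} => /=; rewrite f0 ?addr0 ?add0r.
have := congr1 (tlift F) ht; rewrite (linear_sumE _ tau_linear).
rewrite -[X in _ = tlift F X]scaleN1r (linear_atZ _ _ Fl) [in X in _ = X]scaleN1r.
rewrite !(linear_sumE _ Fl).
under eq_bigr => n _ do
  rewrite (tauE (ha n) (hb n)) (linear_atZ _ _ Fl) (tliftE Fb) (FE _ _ _ (hb n)).
under [X in _ = - X -> _]eq_bigr => n _ do rewrite (tliftE Fb) (FE _ _ _ (ha n)).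
by move=> ->; rewrite opprK.
Qed.

End Operators.

(** * The adjoint action on the tensor square and cube *)

Section Adjoint.
Variables (K : fieldType) (L : superType K).
Variables (br : L -> L -> L) (alpha : L -> L).
Hypothesis alg : HomLieSuperalgebra br alpha.

Let brb := br_bilinear alg.
Let al := alg_alpha_linear alg.
Let ae := alg_alpha_even alg.
Let bre := br_even alg.

Local Notation ad2 := (ad2 br alpha).
Local Notation ad3 := (ad3 br alpha).
Local Notation alpha2 := (tmap alpha alpha).
Local Notation alpha3 := (tmap alpha alpha2).

Let a2l : linear alpha2 := tmap_linear al al.
Let a3l : linear alpha3 := tmap_linear al a2l.

Lemma ad2_linear x : linear (ad2 x).
Proof. by rewrite /Defs.ad2; lin. Qed.

Lemma ad2_linearl u : linear (ad2 ^~ u).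
Proof. by rewrite /Defs.ad2; lin. Qed.

Lemma ad3_linear x : linear (ad3 x).
Proof. by rewrite /Defs.ad3 /tlift3; lin. Qed.

Lemma ad3_linearl u : linear (ad3 ^~ u).
Proof. by rewrite /Defs.ad3 /tlift3; lin. Qed.

Lemma alpha2E x y : alpha2 (x ⊗ y) = alpha x ⊗ alpha y.
Proof. exact: tmapE. Qed.

Lemma alpha3E x y z : alpha3 (x ⊗ (y ⊗ z)) = alpha x ⊗ (alpha y ⊗ alpha z).
Proof. by rewrite tmapE // alpha2E. Qed.

Lemma ad2_even i j x u : homog i x -> homog j u -> homog (i (+) j) (ad2 x u).
Proof.
move=> hx hu; have [I [k [a [b [ha hb ->]]]]] := tensor_decomp hu.
rewrite /homog (linear_sumE _ (ad2_linear x)) linear_sum.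
apply: eq_bigr => n _; rewrite (ad2E brb al _ hx (ha n)) linearD linearZ /=.
congr (_ + _ *: _).
  have := homog_tpure (bre hx (ha n)) (ae (hb n)).
  by rewrite /homog; destruct i, j, (k n).
have := homog_tpure (ae (ha n)) (bre hx (hb n)).
by rewrite /homog; destruct i, j, (k n).
Qed.

Lemma tau_ad2 x u : tau (ad2 x u) = ad2 x (tau u).
Proof.
elim/homog_ind: x => [x x' hx hx'|i x hx].
  rewrite !(linear_atD _ _ (ad2_linearl _)) (linear_atD _ _ (@tau_linear K L)).
  by rewrite hx hx'.
elim/tensor2_homog_ind: u => [|u v hu hv|j k y z hy hz].
- by rewrite !(linear_at0 (@tau_linear K L), linear_at0 (ad2_linear x)).
- rewrite !(linear_atD _ _ (@tau_linear K L), linear_atD _ _ (ad2_linear x)).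
  by rewrite hu hv.
rewrite (ad2E brb al _ hx hy) (tauE hy hz) (linear_atZ _ _ (ad2_linear x)).
rewrite (ad2E brb al _ hx hz) (linear_atD _ _ (@tau_linear K L)).
rewrite (linear_atZ _ _ (@tau_linear K L)).
rewrite (tauE (bre hx hy) (ae hz)) (tauE (ae hy) (bre hx hz)) addrC.
by destruct i, j, k; signs.
Qed.

(** Splitting off the first factor prepares the comparison with [tmap alpha Delta], whose value on a
    pure tensor has this shape. *)
Lemma ad3_tpure i j x y w : homog i x -> homog j y ->
  ad3 x (y ⊗ w) = br x y ⊗ alpha2 w + (-1) ^+ (i && j) *: (alpha y ⊗ ad2 x w).
Proof.
move=> hx hy; elim/tensor2_homog_ind: w => [|u v hu hv|k l z w hz hw].
- by rewrite linear0r (linear_at0 (ad3_linear x)) (linear_at0 a2l)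
    (linear_at0 (ad2_linear x)) !linear0r scaler0 addr0.
- by rewrite linearDr (linear_atD _ _ (ad3_linear x)) (linear_atD _ _ a2l)
    (linear_atD _ _ (ad2_linear x)) !linearDr scalerDr addrACA hu hv.
rewrite (ad3E brb al _ hx hy hz) (ad2E brb al _ hx hz) alpha2E linearDr /=.
by rewrite linearZr_LR /= scalerDr addrA; destruct i, j, k; signs.
Qed.

(** [xi] permutes the three summands of [ad3] cyclically, and the sign of carrying [x] past a factor
    is absorbed by the sign of [xi]. *)
Lemma xi_ad3 x w : xi (ad3 x w) = ad3 x (xi w).
Proof.
elim/homog_ind: x => [x x' hx hx'|i x hx].
  rewrite !(linear_atD _ _ (ad3_linearl _)) (linear_atD _ _ (@xi_linear K L)).
  by rewrite hx hx'.
elim/tensor3_homog_ind: w => [|u v hu hv|j k l y z w hy hz hw].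
- by rewrite !(linear_at0 (@xi_linear K L), linear_at0 (ad3_linear x)).
- rewrite !(linear_atD _ _ (@xi_linear K L), linear_atD _ _ (ad3_linear x)).
  by rewrite hu hv.
rewrite (ad3E brb al _ hx hy hz) (xiE hy hz hw) (linear_atZ _ _ (ad3_linear x)).
rewrite (ad3E brb al _ hx hz hw) !(linear_atD _ _ (@xi_linear K L)).
rewrite !(linear_atZ _ _ (@xi_linear K L)).
rewrite (xiE (bre hx hy) (ae hz) (ae hw)) (xiE (ae hy) (bre hx hz) (ae hw)).
rewrite (xiE (ae hy) (ae hz) (bre hx hw)) -addrA addrC.
by destruct i, j, k, l; signs.
Qed.

Lemma cyc_ad3 x w : cyc (ad3 x w) = ad3 x (cyc w).
Proof. by rewrite /cyc !(linear_atD _ _ (ad3_linear x)) -!xi_ad3. Qed.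

Lemma xi_alpha3 w : xi (alpha3 w) = alpha3 (xi w).
Proof.
elim/tensor3_homog_ind: w => [|u v hu hv|j k l y z w hy hz hw].
- by rewrite !(linear_at0 (@xi_linear K L), linear_at0 a3l).
- by rewrite !(linear_atD _ _ (@xi_linear K L), linear_atD _ _ a3l) hu hv.
rewrite alpha3E (xiE (ae hy) (ae hz) (ae hw)) (xiE hy hz hw).
by rewrite (linear_atZ _ _ a3l) alpha3E.
Qed.

Lemma cyc_alpha3 w : cyc (alpha3 w) = alpha3 (cyc w).
Proof. by rewrite /cyc !(linear_atD _ _ a3l) -!xi_alpha3. Qed.

Section Multiplicative.
Hypothesis mul : Defs.multiplicative br alpha.

Lemma alpha2_ad2 x u : alpha2 (ad2 x u) = ad2 (alpha x) (alpha2 u).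
Proof.
elim/homog_ind: x => [x x' hx hx'|i x hx].
  rewrite (linear_atD _ _ al) !(linear_atD _ _ (ad2_linearl _)).
  by rewrite (linear_atD _ _ a2l) hx hx'.
elim/tensor2_homog_ind: u => [|u v hu hv|j k y z hy hz].
- by rewrite !(linear_at0 a2l, linear_at0 (ad2_linear _)).
- by rewrite !(linear_atD _ _ a2l, linear_atD _ _ (ad2_linear _)) hu hv.
rewrite (ad2E brb al _ hx hy) alpha2E (ad2E brb al _ (ae hx) (ae hy)).
by rewrite (linear_atD _ _ a2l) (linear_atZ _ _ a2l) !alpha2E !mul.
Qed.

Lemma alpha3_ad3 x w : alpha3 (ad3 x w) = ad3 (alpha x) (alpha3 w).
Proof.
elim/homog_ind: x => [x x' hx hx'|i x hx].
  rewrite (linear_atD _ _ al) !(linear_atD _ _ (ad3_linearl _)).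
  by rewrite (linear_atD _ _ a3l) hx hx'.
elim/tensor3_homog_ind: w => [|u v hu hv|j k l y z w hy hz hw].
- by rewrite !(linear_at0 a3l, linear_at0 (ad3_linear _)).
- by rewrite !(linear_atD _ _ a3l, linear_atD _ _ (ad3_linear _)) hu hv.
rewrite (ad3E brb al _ hx hy hz) alpha3E (ad3E brb al _ (ae hx) (ae hy) (ae hz)).
by rewrite !(linear_atD _ _ a3l) !(linear_atZ _ _ a3l) !alpha3E !mul.
Qed.

(** The Hom-Jacobi identity in Leibniz form. *)
Lemma br_leibniz i j x y z : homog i x -> homog j y ->
  br (alpha x) (br y z)
    = br (br x y) (alpha z) + (-1) ^+ (i && j) *: br (alpha y) (br x z).
Proof.
move=> hx hy; elim/homog_ind: z => [z z' hz hz'|k z hz].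
  rewrite !(linear_atD _ _ al, linear_atD _ _ (brb.2 _)) hz hz' scalerDr.
  exact: addrACA.
have brN u v : br u (- v) = - br u v.
  by rewrite -!scaleN1r (linear_atZ _ _ (brb.2 _)).
have := br_jacobi alg hx hy hz.
rewrite (br_skew alg (ae hz) (bre hx hy)) (br_skew alg hz hx) brN.
rewrite (linear_atZ _ _ (brb.2 _)) => jac.
(* The factor [(-1)^(|x||z|)] brings the difference to the normalisation of [br_jacobi]. *)
apply/eqP; rewrite -subr_eq0 -(signr_scale_eq0 (i && k)); apply/eqP.
rewrite -[RHS]jac scalerBr scalerDr opprD addrA.
by destruct i, j, k; signs.
Qed.

(** For an [alpha]-invariant [t] this is the compatibility of [ad(t)] with the bracket. It is
    [br_leibniz] in each factor. *)
Lemma ad2_br i j x y t : homog i x -> homog j y ->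
  ad2 (br x y) (alpha2 t)
    = ad2 (alpha x) (ad2 y t) - (-1) ^+ (i && j) *: ad2 (alpha y) (ad2 x t).
Proof.
move=> hx hy; elim/tensor2_homog_ind: t => [|u v hu hv|k l a b ha hb].
- by rewrite !(linear_at0 a2l, linear_at0 (ad2_linear _)) scaler0 subr0.
- rewrite !(linear_atD _ _ a2l, linear_atD _ _ (ad2_linear _)) hu hv scalerDr.
  by rewrite opprD addrACA.
rewrite alpha2E (ad2E brb al _ (bre hx hy) (ae ha)).
rewrite (ad2E brb al _ hx ha) (ad2E brb al _ hy ha).
rewrite !(linear_atD _ _ (ad2_linear _)) !(linear_atZ _ _ (ad2_linear _)).
rewrite (ad2E brb al _ (ae hx) (bre hy ha)) (ad2E brb al _ (ae hx) (ae ha)).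
rewrite (ad2E brb al _ (ae hy) (bre hx ha)) (ad2E brb al _ (ae hy) (ae ha)).
rewrite (br_leibniz a hx hy) (br_leibniz b hx hy) !mul.
rewrite linearDl linearDr /= linearZl_LR linearZr_LR /=.
by destruct i, j, k; signs;
  (* Summands 1 and 5 carry [[[x,y],-]] and form the left side. The others cancel in pairs: the
     second Leibniz terms, and the terms where [x] and [y] act on different factors. *)
  rewrite [RHS](AC (3*(1*2)*(2*2)) ((1*5)*((2*7)*(3*9)*(4*8)*(6*10))));
  rewrite /= ?(subrr, addNr) !addr0.
Qed.
End Multiplicative.
End Adjoint.

(** * Cyclic sums built from an even skew tensor *)

Section CyclicIdentities.
Variables (K : fieldType) (L : superType K).
Variables (br : L -> L -> L) (alpha : L -> L).
Hypothesis alg : HomLieSuperalgebra br alpha.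

Let brb := br_bilinear alg.
Let al := alg_alpha_linear alg.
Let ae := alg_alpha_even alg.
Let bre := br_even alg.
Let xl := @xi_linear K L.

Local Notation ad2 := (ad2 br alpha).
Local Notation ad3 := (ad3 br alpha).

Variables (I : finType) (j : I -> bool) (a b : I -> L).
Hypothesis ha : forall n, homog (j n) (a n).
Hypothesis hb : forall n, homog (j n) (b n).
Local Notation t := (\sum_n a n ⊗ b n).
Hypothesis t_skew : tau t = - t.

(** As [t] is even, [a n] and [b n] share the parity [j n]: the twist gives [(-1)^(j n)] and
    skewness one more minus. *)
Lemma skew_even_sum (W : lmodType K) (f : bool -> L -> L -> W) :
    (forall p, bilinear_map (f p)) ->
  \sum_n f (j n) (a n) (b n) = \sum_n (-1) ^+ (~~ j n) *: f (j n) (b n) (a n).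
Proof.
move=> fb; rewrite (skew_sum (i := false) ha hb t_skew fb) -sumrN.
by apply: eq_bigr => n _; rewrite /= andbb signrN scaleNr.
Qed.

Lemma ad2_sum x : ad2 x t = \sum_n ad2 x (a n ⊗ b n).
Proof. exact: linear_sumE (ad2_linear alg x). Qed.

Lemma hbrack_sum :
  hbrack br alpha t t = \sum_n \sum_m hbrack br alpha (a n ⊗ b n) (a m ⊗ b m).
Proof.
have hbb := hbrack_bilinear brb al.
rewrite (linear_sumE _ (hbb.1 _)); apply: eq_bigr => n _.
exact: linear_sumE (hbb.2 _).
Qed.

Local Notation mid :=
  (\sum_n \sum_m alpha (a n) ⊗ (br (b n) (a m) ⊗ alpha (b m))).

(* The middle term of [[t, t]]^alpha carries no sign, and [xi] permutes the
   three terms cyclically. *)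
Lemma hbrack_cyc : hbrack br alpha t t = cyc mid.
Proof.
pose A n m := (-1) ^+ (j n && j m) *:
  (br (a n) (a m) ⊗ (alpha (b n) ⊗ alpha (b m))).
pose C n m := (-1) ^+ (j n && j m) *:
  (alpha (a n) ⊗ (alpha (a m) ⊗ br (b n) (b m))).
(* After [xi], the middle term becomes the first by exchanging [a n] with [b n] and then the two
   entries of the bracket. *)
have xiB : xi mid = \sum_n \sum_m A n m.
  rewrite exchange_big (linear_sumE _ xl); apply: eq_bigr => m _.
  rewrite (linear_sumE _ xl).
  under eq_bigr => n _ do
    rewrite (xiE (ae (ha n)) (bre (hb n) (ha m)) (ae (hb m))).
  pose f p u v := (-1) ^+ (p && ((p (+) j m) (+) j m)) *:
    (br v (a m) ⊗ (alpha (b m) ⊗ alpha u)).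
  rewrite (skew_even_sum (f := f)); last by rewrite /f => p; bilin.
  apply: eq_bigr => n _; rewrite /f /A (br_skew alg (ha n) (ha m)).
  by destruct (j n), (j m); signs.
(* Skewness is used once in each copy of [t]; [D] is the stage in between. *)
have xiA : xi (\sum_n \sum_m A n m) = \sum_n \sum_m C n m.
  pose D n m := (-1) ^+ (~~ j n (+) (j n && j m)) *:
    (alpha (b n) ⊗ (alpha (a m) ⊗ br (a n) (b m))).
  transitivity (\sum_n \sum_m D n m).
    rewrite (linear_sumE _ xl); apply: eq_bigr => n _.
    rewrite (linear_sumE _ xl).
    under eq_bigr => m _ do rewrite /A (linear_atZ _ _ xl)
      (xiE (bre (ha n) (ha m)) (ae (hb n)) (ae (hb m))) scalerA.
    pose f p u v := ((-1) ^+ (j n && p) * (-1) ^+ ((j n (+) p) && (j n (+) p))) *: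
      (alpha (b n) ⊗ (alpha v ⊗ br (a n) u)).
    rewrite (skew_even_sum (f := f)); last by rewrite /f => p; bilin.
    apply: eq_bigr => m _; rewrite /f /D.
    by destruct (j n), (j m); signs.
  rewrite exchange_big [RHS]exchange_big; apply: eq_bigr => m _ /=.
  pose f p u v := (-1) ^+ (~~ p (+) (p && j m)) *:
    (alpha v ⊗ (alpha (a m) ⊗ br u (b m))).
  rewrite (skew_even_sum (f := f)); last by rewrite /f => p; bilin.
  apply: eq_bigr => n _; rewrite /f /C.
  by destruct (j n), (j m); signs.
rewrite /cyc xiB xiA hbrack_sum -!big_split; apply: eq_bigr => n _.
rewrite -!big_split; apply: eq_bigr => m _.
rewrite /= (hbrackE brb al _ _ (ha m) (hb n)) andbC [X in X + _ = _]addrC.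
by [].
Qed.

Section Mixed.
Variables (i : bool) (J : finType) (k : J -> bool) (u v : J -> L).
Hypothesis hu : forall n, homog (k n) (u n).
Hypothesis hv : forall n, homog (i (+) k n) (v n).
Local Notation d := (\sum_n u n ⊗ v n).
Hypothesis d_skew : tau d = - d.

(** Each side splits into two families according to the factor that [ad2] brackets. [xi] carries
    [N2] to [M1] by skewness of [t], and [M2] to [N1] by skewness of [d]. In the application [d] is
    [Delta x]. *)
Lemma cyc_ad_swap :
  cyc (\sum_m alpha (u m) ⊗ ad2 (v m) t)
    = cyc (\sum_n alpha (a n) ⊗ ad2 (b n) d).
Proof.
pose M1 m n := alpha (u m) ⊗ (br (v m) (a n) ⊗ alpha (b n)).
pose M2 m n := (-1) ^+ ((i (+) k m) && j n) *:
  (alpha (u m) ⊗ (alpha (a n) ⊗ br (v m) (b n))).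
pose N1 m n := alpha (a n) ⊗ (br (b n) (u m) ⊗ alpha (v m)).
pose N2 m n := (-1) ^+ (j n && k m) *:
  (alpha (a n) ⊗ (alpha (u m) ⊗ br (b n) (v m))).
have -> : \sum_m alpha (u m) ⊗ ad2 (v m) t
    = \sum_m \sum_n M1 m n + \sum_m \sum_n M2 m n.
  rewrite -big_split; apply: eq_bigr => m _.
  rewrite ad2_sum linear_sumr -big_split; apply: eq_bigr => n _.
  by rewrite (ad2E brb al _ (hv m) (ha n)) linearDr linearZr_LR.
have -> : \sum_n alpha (a n) ⊗ ad2 (b n) d
    = \sum_m \sum_n N1 m n + \sum_m \sum_n N2 m n.
  rewrite exchange_big [X in _ = _ + X]exchange_big -big_split.
  apply: eq_bigr => n _.
  rewrite (linear_sumE _ (ad2_linear alg _)) linear_sumr -big_split.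
  apply: eq_bigr => m _.
  by rewrite (ad2E brb al _ (hb n) (hu m)) linearDr linearZr_LR.
have E1 : xi (\sum_m \sum_n N2 m n) = \sum_m \sum_n M1 m n.
  rewrite (linear_sumE _ xl); apply: eq_bigr => m _.
  rewrite (linear_sumE _ xl).
  under eq_bigr => n _ do rewrite /N2 (linear_atZ _ _ xl)
      (xiE (ae (ha n)) (ae (hu m)) (bre (hb n) (hv m))) scalerA.
  pose f p x y := ((-1) ^+ (p && k m) *
      (-1) ^+ (p && (k m (+) (p (+) (i (+) k m))))) *:
      (alpha (u m) ⊗ (br y (v m) ⊗ alpha x)).
  rewrite (skew_even_sum (f := f)); last by rewrite /f => p; bilin.
  apply: eq_bigr => n _; rewrite /f /M1 (br_skew alg (ha n) (hv m)).
  by destruct i, (j n), (k m); signs.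
have E2 : xi (\sum_m \sum_n M2 m n) = \sum_m \sum_n N1 m n.
  rewrite exchange_big [RHS]exchange_big (linear_sumE _ xl).
  apply: eq_bigr => n _.
  rewrite (linear_sumE _ xl).
  under [LHS]eq_bigr => m _ do rewrite /M2 (linear_atZ _ _ xl)
      (xiE (ae (hu m)) (ae (ha n)) (bre (hv m) (hb n))) scalerA.
  pose f p x y := ((-1) ^+ ((i (+) p) && j n) *
      (-1) ^+ (p && (j n (+) ((i (+) p) (+) j n)))) *:
      (alpha (a n) ⊗ (br y (b n) ⊗ alpha x)).
  rewrite (skew_sum (f := f) hu hv d_skew); last by rewrite /f => p; bilin.
  rewrite -sumrN; apply: eq_bigr => m _; rewrite /f /N1 (br_skew alg (hu m) (hb n)).
  by destruct i, (j n), (k m); signs.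
have cl := @cyc_linear K L.
by rewrite !(linear_atD _ _ cl) -E1 -E2 !cyc_xi addrC.
Qed.
End Mixed.

Section AlphaInvariant.
Hypothesis mul : Defs.multiplicative br alpha.
Hypothesis t_alpha : tmap alpha alpha t = t.

(** Invariance of [t] in usable form: an [alpha] on both factors can be inserted or removed under
    any bilinear expression. *)
Lemma alpha_sum (W : lmodType K) (f : L -> L -> W) : bilinear_map f ->
  \sum_n f (alpha (a n)) (alpha (b n)) = \sum_n f (a n) (b n).
Proof.
move=> fb; have fl := tlift_linear fb; have := congr1 (tlift f) t_alpha.
rewrite (linear_sumE _ (tmap_linear al al)) !(linear_sumE _ fl).
under eq_bigr do rewrite (alpha2E alg) (tliftE fb).
by under [RHS]eq_bigr do rewrite (tliftE fb).
Qed.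

Lemma ad2_alpha_sum x : ad2 x t = \sum_n ad2 x (alpha (a n) ⊗ alpha (b n)).
Proof.
rewrite ad2_sum; apply/esym/(@alpha_sum _ (fun y z => ad2 x (y ⊗ z))).
have xla := ad2_linear alg x; split=> ?; apply: linear_compose => //; lin.
Qed.

Lemma alpha3_mid : tmap alpha (tmap alpha alpha) mid = mid.
Proof.
have a3l := tmap_linear al (tmap_linear al al).
pose f y z := \sum_m alpha y ⊗ (br z (a m) ⊗ alpha (b m)).
rewrite -[RHS](@alpha_sum _ f); last by rewrite /f; bilin.
rewrite (linear_sumE _ a3l); apply: eq_bigr => n _; rewrite (linear_sumE _ a3l).
pose g y z := alpha (alpha (a n)) ⊗ (br (alpha (b n)) y ⊗ alpha z).
rewrite /f -[RHS](@alpha_sum _ g); last by rewrite /g; bilin.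
by apply: eq_bigr => m _; rewrite (alpha3E alg) mul.
Qed.

(** The families [L1] and [L3] occur on both sides. By skewness of [t] and of the bracket, [xi]
    turns [L2] into [R3] and [L4] into [R4], up to exchanging the two copies of [t]. *)
Lemma cyc_ad_ad i x : homog i x ->
  cyc (tmap alpha (fun v => ad2 v t) (ad2 x t)) = cyc (ad3 (alpha x) mid).
Proof.
move=> hx; have adl := ad2_linearl alg t; have cl := @cyc_linear K L.
pose L1 n m := alpha (br x (a n)) ⊗
  (br (alpha (b n)) (alpha (a m)) ⊗ alpha (alpha (b m))).
pose L2 n m := (-1) ^+ (j n && j m) *: (alpha (br x (a n)) ⊗
  (alpha (alpha (a m)) ⊗ br (alpha (b n)) (alpha (b m)))).
pose L3 n m := (-1) ^+ (i && j n) *: (alpha (alpha (a n)) ⊗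
  (br (br x (b n)) (alpha (a m)) ⊗ alpha (alpha (b m)))).
pose L4 n m := (-1) ^+ ((i && j n) (+) ((i (+) j n) && j m)) *:
  (alpha (alpha (a n)) ⊗
    (alpha (alpha (a m)) ⊗ br (br x (b n)) (alpha (b m)))).
pose R3 n m := (-1) ^+ (i && j m) *: (alpha (alpha (a n)) ⊗
  (alpha (br (b n) (a m)) ⊗ br (alpha x) (alpha (b m)))).
pose R4 n m := alpha (alpha (a n)) ⊗
  (br (alpha (b n)) (br x (a m)) ⊗ alpha (alpha (b m))).
have -> : tmap alpha (fun v => ad2 v t) (ad2 x t)
  = \sum_n \sum_m L1 n m + \sum_n \sum_m L2 n m
    + (\sum_n \sum_m L3 n m + \sum_n \sum_m L4 n m).
  rewrite ad2_sum (linear_sumE _ (tmap_linear al adl)).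
  rewrite -!big_split; apply: eq_bigr => n _.
  rewrite (ad2E brb al _ hx (ha n)) (linear_atD _ _ (tmap_linear al adl)).
  (* Invariance of the inner copy of [t] supplies the additional [alpha] found in the terms of
     [ad3 (alpha x) mid]. *)
  rewrite (linear_atZ _ _ (tmap_linear al adl)) !tmapE // !ad2_alpha_sum.
  rewrite !linear_sumr scaler_sumr -!big_split; apply: eq_bigr => m _.
  rewrite (ad2E brb al _ (ae (hb n)) (ae (ha m))).
  rewrite (ad2E brb al _ (bre hx (hb n)) (ae (ha m))).
  by rewrite !linearDr !linearZr_LR scalerDr scalerA -signr_addb.
have -> : ad3 (alpha x) mid
  = \sum_n \sum_m L1 n m + \sum_n \sum_m R3 n m
    + (\sum_n \sum_m L3 n m + \sum_n \sum_m R4 n m).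
  rewrite (linear_sumE _ (ad3_linear alg _)).
  rewrite -!big_split; apply: eq_bigr => n _.
  rewrite (linear_sumE _ (ad3_linear alg _)).
  rewrite -!big_split; apply: eq_bigr => m _.
  rewrite (ad3E brb al _ (ae hx) (ae (ha n)) (bre (hb n) (ha m))).
  (* Hom-Jacobi on the middle factor [[alpha(x),[b,a']]] produces [L3] and [R4]. *)
  rewrite (br_leibniz alg _ hx (hb n)) -!mul addrAC.
  rewrite linearDl linearDr /= linearZl_LR linearZr_LR scalerDr scalerA.
  rewrite -signr_addb addbb scale1r.
  by rewrite addKb /L1 /R3 -!mul.
have E2 : xi (\sum_n \sum_m L2 n m) = \sum_n \sum_m R3 n m.
  rewrite exchange_big (linear_sumE _ xl).
  apply: eq_bigr => m _; rewrite (linear_sumE _ xl).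
  under [LHS]eq_bigr => n _ do rewrite /L2 (linear_atZ _ _ xl)
    (xiE (ae (bre hx (ha n))) (ae (ae (ha m))) (bre (ae (hb n)) (ae (hb m))))
    scalerA.
  pose f p y z := ((-1) ^+ (p && j m) *
      (-1) ^+ ((i (+) p) && (j m (+) (p (+) j m)))) *:
    (alpha (alpha (a m)) ⊗ (br (alpha z) (alpha (b m)) ⊗ alpha (br x y))).
  rewrite (skew_even_sum (f := f)); last by rewrite /f => p; bilin.
  apply: eq_bigr => n _.
  rewrite /f /R3 (br_skew alg (ae (ha n)) (ae (hb m))) -!mul.
  by destruct i, (j n), (j m); signs.
have E4 : xi (\sum_n \sum_m L4 n m) = \sum_n \sum_m R4 n m.
  rewrite exchange_big (linear_sumE _ xl).
  apply: eq_bigr => m _; rewrite (linear_sumE _ xl).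
  under [LHS]eq_bigr => n _ do rewrite /L4 (linear_atZ _ _ xl)
    (xiE (ae (ae (ha n))) (ae (ae (ha m))) (bre (bre hx (hb n)) (ae (hb m))))
    scalerA.
  pose f p y z := ((-1) ^+ ((i && p) (+) ((i (+) p) && j m)) *
      (-1) ^+ (p && (j m (+) ((i (+) p) (+) j m)))) *:
    (alpha (alpha (a m)) ⊗ (br (br x z) (alpha (b m)) ⊗ alpha (alpha y))).
  rewrite (skew_even_sum (f := f)); last by rewrite /f => p; bilin.
  apply: eq_bigr => n _.
  rewrite /f /R4 (br_skew alg (ae (hb m)) (bre hx (ha n))).
  by destruct i, (j n), (j m); signs.
by rewrite !(linear_atD _ _ cl) -E2 -E4 !cyc_xi.
Qed.

End AlphaInvariant.

End CyclicIdentities.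

(** * The cobracket and its interaction with [ad2] *)

Lemma half_skew (K : fieldType) (L : superType K) (u : (L ⊗ L)%type) :
  (2 : K) != 0 -> tau u = - u -> exists s, u = s - tau s.
Proof.
move=> two tu; exists (2^-1 *: u).
have tl := @tau_linear K L.
rewrite (linear_atZ _ _ tl) tu scalerN opprK -scalerDl.
by rewrite -[2^-1]mulr1 -mulrDr mulVf // scale1r.
Qed.

Lemma tmapDr (K : fieldType) (U V U' V' : lmodType K) (f : U -> U')
    (g h : V -> V') (u : (U ⊗ V)%type) : linear f -> linear g -> linear h ->
  tmap f (fun v => g v + h v) u = tmap f g u + tmap f h u.
Proof.
move=> fl gl hl; have ghl := linear_add gl hl.
elim/tensor_ind: u => [|u v hu hv|x y].
- by rewrite !(linear_at0 (tmap_linear _ _)) // addr0.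
- by rewrite !(linear_atD _ _ (tmap_linear _ _)) // hu hv addrACA.
- by rewrite !tmapE // linearDr.
Qed.

Section Cobracket.
Variables (K : fieldType) (L : superType K).
Variables (br : L -> L -> L) (Delta : L -> (L ⊗ L)%type) (alpha : L -> L).
Hypothesis bialg : MultHomLieSuperbialgebra br Delta alpha.

Let alg := bialg_alg bialg.
Let coalg := bialg_coalg bialg.
Let mul := bialg_mult bialg.
Let brb := br_bilinear alg.
Let al := alg_alpha_linear alg.
Let ae := alg_alpha_even alg.
Let Dl := Delta_linear coalg.

Local Notation ad2 := (ad2 br alpha).
Local Notation ad3 := (ad3 br alpha).

Lemma tau_Delta x : tau (Delta x) = - Delta x.
Proof.
have [s ->] := Delta_skew coalg x.
have tl := @tau_linear K L.
by rewrite -scaleN1r (linear_atD _ _ tl) (linear_atZ _ _ tl) tauK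
  !scaleN1r opprB addrC.
Qed.

(** Compatibility expands [Delta [x, b]]; its first term and comultiplicativity rebuild [ad3]
    through [ad3_tpure]. The sign of its second term cancels the Koszul sign of [ad2], so the error
    sum is unsigned. *)
Lemma Delta_ad2 (I : finType) (j : I -> bool) (a b : I -> L) i x :
    (forall n, homog (j n) (a n)) -> (forall n, homog (j n) (b n)) ->
    homog i x ->
  tmap alpha Delta (ad2 x (\sum_n a n ⊗ b n))
    = ad3 (alpha x) (tmap alpha Delta (\sum_n a n ⊗ b n))
      - \sum_n alpha (alpha (a n)) ⊗ ad2 (alpha (b n)) (Delta x).
Proof.
move=> ha hb hx; have aDl := tmap_linear al Dl.
rewrite (linear_sumE _ (ad2_linear alg x)) !(linear_sumE _ aDl).
rewrite (linear_sumE _ (ad3_linear alg _)) -sumrB; apply: eq_bigr => n _.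
rewrite (ad2E brb al _ hx (ha n)) (linear_atD _ _ aDl) (linear_atZ _ _ aDl).
rewrite !tmapE // (ad3_tpure alg _ (ae hx) (ae (ha n))).
rewrite (bialg_comult bialg) mul (bialg_compat bialg hx (hb n)).
rewrite linearBr linearZr_LR scalerBr scalerA -signr_addb addbb scale1r.
by rewrite addrA.
Qed.

Lemma alpha3_Delta t : tmap alpha alpha t = t ->
  tmap alpha (tmap alpha alpha) (tmap alpha Delta t) = tmap alpha Delta t.
Proof.
(* With [t] on the right replaced by its image, the identity holds for every tensor, so induction
   applies. *)
move=> t_alpha; rewrite -{2}t_alpha.
have a2l := tmap_linear al al; have aDl := tmap_linear al Dl.
have a3l := tmap_linear al a2l.
elim/tensor_ind: {t_alpha}t => [|u v hu hv|y z].
- by rewrite (linear_at0 a2l) (linear_at0 aDl) (linear_at0 a3l).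
- by rewrite (linear_atD _ _ a2l) !(linear_atD _ _ aDl) (linear_atD _ _ a3l) hu hv.
- by rewrite (alpha2E alg) !tmapE // (bialg_comult bialg).
Qed.

End Cobracket.

(** * The twisted superbialgebra *)

Theorem theorem4p1 (K : fieldType) (L : superType K)
    (br : L -> L -> L) (Delta : L -> L ⊗ L) (alpha : L -> L) (t : L ⊗ L) :
  [pchar K] =i pred0 ->
  MultHomLieSuperbialgebra br Delta alpha ->
  homog false t ->
  tmap alpha alpha t = t ->
  tau t = - t ->
  (forall x : L,
     tmap alpha (tmap alpha alpha)
       (ad3 br alpha x
          (hbrack br alpha t t + cyc (tmap alpha Delta t))) = 0) ->
  MultHomLieSuperbialgebra br (fun x => Delta x + ad2 br alpha x t) alpha.
Proof.
move=> charK bialg t_even t_alpha t_skew t_ybe.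
have [alg mul coalg comul compat] := (bialg).
have al := alg_alpha_linear alg; have Dl := Delta_linear coalg.
have adl := ad2_linearl alg t.
have Dtl := linear_add Dl adl.
split=> //; first split=> //.
- move=> i x hx; rewrite /homog linearD /= (Delta_even coalg hx).
  by rewrite -[i in hcomp i _]addbF (ad2_even alg hx t_even).
- exact: alg_alpha_even alg.
(* Characteristic [0] makes [2] invertible, so a skew tensor is [s - tau s] with [s] its half. *)
- move=> x; apply: half_skew.
    by have := charK 2; rewrite !inE /= => ->.
  rewrite (linear_atD _ _ (@tau_linear K L)) (tau_Delta bialg) (tau_ad2 alg).
  rewrite t_skew -[in LHS]scaleN1r (linear_atZ _ _ (ad2_linear alg x)).
  by rewrite scaleN1r opprD.
- have cDl : linear (fun x => cyc (tmap alpha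
      (fun y => Delta y + ad2 br alpha y t) (Delta x + ad2 br alpha x t))).
    exact: linear_compose (@cyc_linear K L)
      (linear_compose (tmap_linear al Dtl) Dtl).
  elim/homog_ind => [x y hx hy|i x hx].
    by rewrite (linear_atD _ _ cDl) hx hy addr0.
  have dsk := tau_Delta bialg x.
  have [I [j [a [b [ha hb tE]]]]] := tensor_decomp t_even.
  have [J [k [u [v [hu hv dE]]]]] := tensor_decomp (Delta_even coalg hx).
  have cl := @cyc_linear K L.
  (* The hypothesis is brought to the form [ybe]: [cyc] of [(alpha ⊗ ad(t))(ad_x t)] plus [cyc] of
     [ad_{alpha(x)}((alpha ⊗ Delta)(t))] is [0]. *)
  have := t_ybe x; rewrite (alpha3_ad3 alg mul).
  have a3l := tmap_linear al (tmap_linear al al).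
  rewrite (linear_atD _ _ a3l) -(cyc_alpha3 alg) (alpha3_Delta bialg t_alpha).
  rewrite {1 2}tE (hbrack_cyc alg ha hb); last by rewrite -tE.
  rewrite -(cyc_alpha3 alg) (alpha3_mid alg mul); last by rewrite -tE.
  rewrite (linear_atD _ _ (ad3_linear alg _)) -!(cyc_ad3 alg).
  rewrite -(cyc_ad_ad alg ha hb _ mul _ hx); try by rewrite -tE.
  rewrite -tE => ybe.
  (* Of the four terms of the expansion, the one with [Delta] twice vanishes by the co-Jacobi
     identity of [Delta]. *)
  rewrite tmapDr // !(linear_atD _ _ (tmap_linear al _)) //.
  rewrite !(linear_atD _ _ cl) (Delta_cojacobi coalg) add0r.
  rewrite {1}tE (Delta_ad2 bialg ha hb hx) -tE.
  (* The mixed term with [ad(t)] outside cancels the error sum of [Delta_ad2]; what is left is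
     [ybe]. *)
  have swap : cyc (tmap alpha (fun v => ad2 br alpha v t) (Delta x))
      = cyc (\sum_n alpha (alpha (a n)) ⊗ ad2 br alpha (alpha (b n)) (Delta x)).
    have aadl := tmap_linear al adl.
    pose f y z := alpha y ⊗ ad2 br alpha z (Delta x).
    have fb : bilinear_map f.
      have adxl := ad2_linearl alg (Delta x).
      by split=> ?; [exact: tpure_linearl|exact: tpure_linearr].
    rewrite (alpha_sum alg _ fb); last by rewrite -tE.
    rewrite /f dE tE.
    rewrite -(cyc_ad_swap alg ha hb _ hu hv); [|by rewrite -tE|by rewrite -dE].
    by rewrite -tE (linear_sumE _ aadl); under eq_bigr do rewrite tmapE //.
  rewrite -scaleN1r (linear_atD _ _ cl) (linear_atZ _ _ cl) swap scaleN1r.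
  by rewrite addrA addrNK addrC.
- move=> x; rewrite comul -{1}t_alpha -(alpha2_ad2 alg mul).
  by rewrite (linear_atD _ _ (tmap_linear al al)).
- move=> i j x y hx hy.
  (* Invariance turns [ad2 (br x y) t] into the left side of [ad2_br]; the two compatibilities then
     add up. *)
  rewrite (compat _ _ _ _ hx hy) -{1}t_alpha (ad2_br alg mul _ hx hy).
  rewrite !(linear_atD _ _ (ad2_linear alg _)) scalerDr opprD.
  exact: addrACA.
Qed.
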